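(* For $\gamma\in\Pi^0\mathrm{Aut}^+(\Lambda[B,q])$, let $R[B,q]$ be given the topology for which the subsets $R(\gamma,\xi)$, for all $\xi\in\Pi^0\Lambda[B,q]^\times$, form a neighborhood base at $\{0\}$. This topology on $R[B,q]$ is independent of $\gamma$.
   Context: $B$ is a finite-dimensional local supercommutative $\mathbb C$-algebra, $q$ a positive integer, $X_0$ a fixed smooth projective (connected) curve over $\mathbb C$ with algebraic structure sheaf $\mathcal O_0$ and function field $\mathbb C(X_0)$. $B[\theta_1,\dots,\theta_q]$ is the Grassmann algebra over $B$ on $q$ odd generators. $\mathcal O[B,q]=B[\theta_1,\dots,\theta_q]\otimes_{\mathbb C}\mathcal O_0$ and $\Lambda[B,q]=B[\theta_1,\dots,\theta_q]\otimes_{\mathbb C}\mathbb C(X_0)$. $\Lambda[B,q]^\times$ is the group of even units of $\Lambda[B,q]$. For a supercommutative ring $R$ with nilpotent ideal $n(R)$, $\mathrm{Aut}^+(R)$ is the kernel of $\mathrm{Aut}(R)\to\mathrm{Aut}(R/n(R))$; here automorphisms of $\Lambda[B,q]$ are parity-preserving $B$-algebra automorphisms. For a group $G$ (here $G=\mathrm{Aut}^+(\Lambda[B,q])$ or $\Lambda[B,q]^\times$), $\Pi^0G$ is the set of maps $X_0\to G$, $P\mapsto\eta_P$, equal to the identity element for all but finitely many $P$. A répartition is a map $r:X_0\to\Lambda[B,q]$, $P\mapsto r_P$, with $r_P\in\mathcal O[B,q]_P$ for all but finitely many $P$; $R[B,q]$ is the set of all répartitions. For $\gamma\in\Pi^0\mathrm{Aut}^+(\Lambda[B,q])$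 and $\xi\in\Pi^0\Lambda[B,q]^\times$, $R(\gamma,\xi)\subset R[B,q]$ is the set of $r$ such that $r_P\in\gamma_P(\xi_P\,\mathcal O[B,q]_P)$ for every $P\in X_0$. *)

(* Defs.v *)
From HB Require Import structures.
From mathcomp Require Import all_boot all_order all_algebra all_field.
Set Implicit Arguments.
Unset Strict Implicit.
Unset Printing Implicit Defensive.

Import Order.TTheory GRing.Theory Num.Theory.

Local Open Scope ring_scope.

Section BaseChange.
Variables (F K : fieldType) (iota : {rmorphism F -> K}) (A : falgType F).

(* A (x)_F K for a finite-dimensional F-algebra A and an extension iota of
   fields, in coordinates with respect to the F-basis [vbasis {:A}] of A; the
   argument iota, which only matters for the product, is kept in the type.
   [tens a k] is the pure tensor a (x) k. *)
Definition base_change (k : {rmorphism F -> K}) (V : falgType F) : Type :=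
  'rV[K]_(\dim {:V}).
HB.instance Definition _ := GRing.Lmodule.on (base_change iota A).
Local Notation AK := (base_change iota A).
Local Notation e := (vbasis {:A}).

Definition tens (a : A) (k : K) : AK := \row_i (k * iota (coord e i a)).

Definition bc_mul (x y : AK) : AK :=
  \sum_(i < \dim {:A}) \sum_(j < \dim {:A}) tens (e`_i * e`_j) (x 0 i * y 0 j).

Lemma tensDl a b k : tens (a + b) k = tens a k + tens b k.
Proof. by apply/rowP => i; rewrite !mxE linearD rmorphD mulrDr. Qed.

Lemma tensDr a k l : tens a (k + l) = tens a k + tens a l.
Proof. by apply/rowP => i; rewrite !mxE mulrDl. Qed.

Lemma tensZr a k l : tens a (k * l) = k *: tens a l.
Proof. by apply/rowP => i; rewrite !mxE mulrA. Qed.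

Lemma tensZl c a k : tens (c *: a) k = tens a (iota c * k).
Proof.
by apply/rowP => i; rewrite !mxE linearZ rmorphM mulrCA mulrA.
Qed.

Lemma tens_suml I (r : seq I) (P : pred I) (f : I -> A) k :
  tens (\sum_(i <- r | P i) f i) k = \sum_(i <- r | P i) tens (f i) k.
Proof.
elim/big_rec2: _ => [|i x y _ <-]; last by rewrite tensDl.
by apply/rowP => j; rewrite !mxE linear0 rmorph0 mulr0.
Qed.

Lemma tens_basis (x : AK) : x = \sum_(i < \dim {:A}) tens e`_i (x 0 i).
Proof.
apply/rowP => j; rewrite summxE (bigD1 j) //= big1 => [|i ij].
  by rewrite addr0 mxE (coord_free _ _ (basis_free (vbasisP _))) eqxx rmorph1 mulr1.
rewrite mxE (coord_free _ _ (basis_free (vbasisP _))).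
by rewrite [_ == _](negbTE ij) rmorph0 mulr0.
Qed.

Lemma coordE (a : A) : a = \sum_(i < \dim {:A}) coord e i a *: e`_i.
Proof. exact: (coord_vbasis (memvf a)). Qed.

Lemma bc_mulDl : left_distributive bc_mul +%R.
Proof.
move=> x y z; rewrite /bc_mul -big_split /=; apply: eq_bigr => i _.
by rewrite -big_split /=; apply: eq_bigr => j _; rewrite mxE mulrDl tensDr.
Qed.

Lemma bc_mulDr : right_distributive bc_mul +%R.
Proof.
move=> x y z; rewrite /bc_mul -big_split /=; apply: eq_bigr => i _.
by rewrite -big_split /=; apply: eq_bigr => j _; rewrite mxE mulrDr tensDr.
Qed.

Lemma bc_tensM a b k l : bc_mul (tens a k) (tens b l) = tens (a * b) (k * l).
Proof.
rewrite {2}(coordE a) mulr_suml tens_suml; apply: eq_bigr => i _.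
rewrite {2}(coordE b) mulr_sumr tens_suml; apply: eq_bigr => j _.
rewrite !mxE -scalerAl -scalerAr !tensZl; congr tens.
by rewrite mulrACA [RHS]mulrA [RHS]mulrC [in RHS](mulrC (iota _)).
Qed.


Lemma tens_ind (P : AK -> Prop) : (forall x y, P x -> P y -> P (x + y)) ->
  (forall a k, P (tens a k)) -> forall x, P x.
Proof.
move=> PD Pt x; rewrite (tens_basis x).
apply: big_ind => //.
by rewrite (_ : 0 = tens 0 0) //; apply/rowP => i; rewrite !mxE mul0r.
Qed.

Lemma bc_mulA : associative bc_mul.
Proof.
move=> x y z; elim/tens_ind: x => [x x' IH IH'|a k].
  by rewrite !bc_mulDl IH IH'.
elim/tens_ind: y => [y y' IH IH'|b l].
  by rewrite !(bc_mulDl, bc_mulDr) IH IH'.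
elim/tens_ind: z => [z z' IH IH'|c m].
  by rewrite !bc_mulDr IH IH'.
by rewrite !bc_tensM !mulrA.
Qed.

Lemma bc_mul1l : left_id (tens 1 1) bc_mul.
Proof.
move=> x; elim/tens_ind: x => [x y IH IH'|a k].
  by rewrite bc_mulDr IH IH'.
by rewrite bc_tensM !mul1r.
Qed.

Lemma bc_mul1r : right_id (tens 1 1) bc_mul.
Proof.
move=> x; elim/tens_ind: x => [x y IH IH'|a k].
  by rewrite bc_mulDl IH IH'.
by rewrite bc_tensM !mulr1.
Qed.

Lemma bc_1neq0 : tens 1 1 != 0.
Proof.
apply/eqP => H; have /eqP[] := oner_neq0 A.
rewrite (coordE 1) big1 // => i _.
have /rowP/(_ i) := H; rewrite !mxE mul1r => /eqP.
by rewrite fmorph_eq0 => /eqP ->; rewrite scale0r.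
Qed.

HB.instance Definition _ := GRing.Zmodule_isNzRing.Build AK
  bc_mulA bc_mul1l bc_mul1r bc_mulDl bc_mulDr bc_1neq0.

Lemma tensM a b k l : tens a k * tens b l = tens (a * b) (k * l).
Proof. exact: bc_tensM. Qed.
End BaseChange.

(* A finite-dimensional Z/2-graded algebra: [part false] is the even part and
   [part true] the odd part. *)
Record superalgebra (F : fieldType) := SuperAlgebra {
  carrier :> falgType F;
  part : bool -> {vspace carrier};
  part_sum : (part false + part true = {:carrier})%VS;
  part_direct : (part false :&: part true = 0)%VS;
  part1 : 1 \in part false;
  partM : forall (s t : bool) (x y : carrier),
    x \in part s -> y \in part t -> x * y \in part (s (+) t)
}.

Definition supercommutative (F : fieldType) (A : superalgebra F) : Prop :=
  forall (s t : bool) (x y : A), x \in part A s -> y \in part A t ->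
    x * y = (-1) ^+ (s && t) * (y * x).

(* The non-units are closed under addition (falgType's are non-trivial). *)
Definition local_algebra (F : fieldType) (A : superalgebra F) : Prop :=
  forall x y : A, x \isn't a GRing.unit -> y \isn't a GRing.unit ->
    x + y \isn't a GRing.unit.

Section Involution.
Variables (F : fieldType) (A : superalgebra F).

(* a_0 + a_1 |-> a_0 - a_1 *)
Definition grade_inv (a : A) : A :=
  daddv_pi (part A false) (part A true) a
  - daddv_pi (part A true) (part A false) a.


Lemma grade_inv_linear : linear grade_inv.
Proof.
move=> c a b; rewrite /grade_inv [daddv_pi _ _ (_ + _)]linearP.
rewrite [X in _ - X]linearP.
by rewrite opprD addrACA scalerBr.
Qed.
HB.instance Definition _ :=
  GRing.isLinear.Build F A A _ grade_inv grade_inv_linear.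

Lemma grade_inv_part s a : a \in part A s -> grade_inv a = (-1) ^+ s * a.
Proof.
have d01 := part_direct A; have d10 := d01; rewrite capvC in d10.
have f w : w \in (part A false + part A true)%VS by rewrite part_sum memvf.
rewrite /grade_inv; have E := daddv_pi_add d01 (f a).
case: s => aA; rewrite (daddv_pi_id _ aA) // in E *; move: E.
  move=> /(canRL (addrK _)); rewrite subrr => ->.
  by rewrite sub0r mulN1r.
by move=> /(canRL (addKr _)); rewrite addNr => ->; rewrite subr0 mul1r.
Qed.

Lemma grade_invD : {morph grade_inv : a b / a + b}.
Proof. exact: linearD. Qed.

Lemma part_ind (P : A -> Prop) : (forall a b, P a -> P b -> P (a + b)) ->
  (forall s a, a \in part A s -> P a) -> forall a, P a.
Proof.
move=> PD Ps a; have: a \in (part A false + part A true)%VS.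
  by rewrite part_sum memvf.
by case/memv_addP => u u0 [v v1 ->]; apply: PD; apply: Ps; eassumption.
Qed.

Lemma grade_invM : {morph grade_inv : a b / a * b}.
Proof.
move=> a b; elim/part_ind: a => [a a' IH IH'|s a as_].
  by rewrite mulrDl !grade_invD IH IH' [RHS]mulrDl.
elim/part_ind: b => [b b' IH IH'|t b bt].
  by rewrite mulrDr !grade_invD IH IH' [RHS]mulrDr.
rewrite (grade_inv_part (partM as_ bt)) (grade_inv_part as_) (grade_inv_part bt).
by case: s t {as_ bt} => [] []; rewrite /= ?expr0 ?mul1r ?mulN1r ?mulrN ?mulNr ?opprK.
Qed.

Lemma grade_inv1 : grade_inv 1 = 1.
Proof. by rewrite (grade_inv_part (part1 A)) mul1r. Qed.

Definition twist (n : nat) (a : A) : A := iter n grade_inv a.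

Lemma twist_linear n : linear (twist n).
Proof.
by move=> c a b; elim: n => [|n] //=; rewrite /twist /= => ->; rewrite linearP.
Qed.
HB.instance Definition _ n :=
  GRing.isLinear.Build F A A _ (twist n) (twist_linear n).

Lemma twistM n : {morph twist n : a b / a * b}.
Proof. by move=> a b; elim: n => [|n] //; rewrite /twist /= => ->; rewrite grade_invM. Qed.

Lemma twist1 n : twist n 1 = 1.
Proof. by elim: n => [|n] //; rewrite /twist /= => ->; rewrite grade_inv1. Qed.

Lemma twist_sign m n a : twist m ((-1) ^+ n * a) = (-1) ^+ n * twist m a.
Proof. by rewrite -signr_odd !mulr_sign; case: odd; rewrite ?linearN. Qed.

Lemma twistD m n a : twist m (twist n a) = twist (m + n) a.
Proof. by rewrite /twist iterD. Qed.
End Involution.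

Section Grassmann.
Variables (F : fieldType) (A : superalgebra F) (q : nat).

(* B[theta_1, ..., theta_q], the theta_i being odd: f stands for
   sum_I f(I) theta_I, with theta_I the product of the theta_i for i in I, in
   increasing order, and coefficients on the left. Since
   theta_I b = (-1)^(|I| |b|) b theta_I for homogeneous b, and
   theta_I theta_J = (-1)^(inversions I J) theta_(I u J) if I and J are disjoint
   and 0 otherwise, the product is [gr_mul]. *)
Definition grassmann (B : superalgebra F) (r : nat) : Type :=
  {ffun {set 'I_r} -> B}.
HB.instance Definition _ := Vector.on (grassmann A q).
Local Notation G := (grassmann A q).
Implicit Types (f g h : G) (I J S T : {set 'I_q}).

Definition inversions I J : nat := #|[set p in setX I J | (p.2 < p.1)%N]|.

Definition gr_one : G := [ffun S => if S == set0 then 1 else 0].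

Definition gr_mul f g : G := [ffun S : {set 'I_q} =>
  \sum_(I : {set 'I_q} | I \subset S) (-1) ^+ inversions I (S :\: I)
     * (f I * twist #|I| (g (S :\: I)))].

Lemma inversionsUl I J S : [disjoint I & J] ->
  inversions (I :|: J) S = (inversions I S + inversions J S)%N.
Proof.
move=> dIJ; rewrite /inversions -cardsUI.
rewrite [X in (_ + X)%N](_ : _ = 0%N) ?addn0.
  apply: eq_card => -[i j]; rewrite !inE /=.
  by case: (i \in I); case: (i \in J); case: (j \in S); case: (j < i)%N.
apply/eqP; rewrite cards_eq0; apply/eqP/setP => -[i j]; rewrite !inE /=.
case iI: (i \in I) => //=; rewrite (disjointFr dIJ iI) /= andbF //.
Qed.

Lemma inversionsUr I J S : [disjoint I & J] ->
  inversions S (I :|: J) = (inversions S I + inversions S J)%N.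
Proof.
move=> dIJ; rewrite /inversions -cardsUI.
rewrite [X in (_ + X)%N](_ : _ = 0%N) ?addn0.
  apply: eq_card => -[i j]; rewrite !inE /=.
  by case: (j \in I); case: (j \in J); case: (i \in S); case: (j < i)%N.
apply/eqP; rewrite cards_eq0; apply/eqP/setP => -[i j]; rewrite !inE /=.
case jI: (j \in I); rewrite /= ?andbF //= (disjointFr dIJ jI) /= !andbF //.
Qed.

Lemma gr_mulDl : left_distributive gr_mul +%R.
Proof.
move=> f g h; apply/ffunP => S; rewrite !ffunE -big_split /=.
by apply: eq_bigr => I _; rewrite !ffunE mulrDl mulrDr.
Qed.

Lemma gr_mulDr : right_distributive gr_mul +%R.
Proof.
move=> f g h; apply/ffunP => S; rewrite !ffunE -big_split /=.
by apply: eq_bigr => I _; rewrite !ffunE linearD !mulrDr.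
Qed.

Lemma gr_mul1l : left_id gr_one gr_mul.
Proof.
move=> f; apply/ffunP => S; rewrite !ffunE (bigD1 set0) ?sub0set //= big1.
  rewrite ffunE eqxx cards0 /= mul1r setD0 addr0 /inversions.
  rewrite (_ : [set _ in _ | _] = set0) ?cards0 ?mul1r //.
  by apply/setP => -[i j]; rewrite !inE.
by move=> I /andP[_ /negbTE I0]; rewrite ffunE I0 mul0r mulr0.
Qed.

Lemma gr_mul1r : right_id gr_one gr_mul.
Proof.
move=> f; apply/ffunP => S; rewrite !ffunE (bigD1 S) //= big1.
  rewrite ffunE setDv eqxx twist1 mulr1 addr0 /inversions.
  rewrite (_ : [set _ in _ | _] = set0) ?cards0 ?mul1r //.
  by apply/setP => -[i j]; rewrite !inE andbF.
move=> I /andP[IS nIS]; rewrite ffunE setD_eq0.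
case: ifP => [SI|_]; last by rewrite linear0 !mulr0.
by rewrite eqEsubset IS SI in nIS.
Qed.

Lemma signr_comm n (a b : A) : a * ((-1) ^+ n * b) = (-1) ^+ n * (a * b).
Proof. by rewrite !mulrA (commr_sign a n). Qed.

Lemma gr_mulA : associative gr_mul.
Proof.
move=> f g h; apply/ffunP => S; rewrite !ffunE.
pose E I J := (-1) ^+ (inversions I (S :\: I) + inversions J (S :\: I :\: J))
  * (f I * (twist #|I| (g J)
      * twist (#|I| + #|J|) (h (S :\: I :\: J)))).
transitivity (\sum_(I : {set 'I_q} | I \subset S)
   \sum_(T : {set 'I_q} | (I \subset T) && (T \subset S)) E I (T :\: I)).
  apply: eq_bigr => I IS; rewrite ffunE linear_sum /= !mulr_sumr.
  rewrite (reindex_onto (fun T => T :\: I) (fun J => I :|: J)) /=; last first.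
    move=> J; rewrite subsetD => /andP[_ dJI].
    rewrite setDUl setDv set0U; apply/setDidPl => //.
  apply: eq_big => [T|T _].
    apply/andP/andP => [[TS /eqP <-]|[IT TS]]; split.
    - exact: subsetUl.
    - by rewrite subUset IS (subset_trans TS) ?subsetDl.
    - exact: setSD.
    - apply/eqP/setP => x; rewrite !inE; have := fintype.subsetP IT x.
      by case: (x \in I) => //= ->.
  by rewrite twist_sign twistM signr_comm mulrA -exprD /E twistD.
rewrite (exchange_big_dep (fun T : {set 'I_q} => T \subset S)) /=; last first.
  by move=> I T _ /andP[].
apply: eq_bigr => T TS; rewrite ffunE mulr_suml mulr_sumr.
apply: eq_big => [I|I /andP[IS /andP[IT _]]].
  rewrite TS andbT; apply/andP/idP => [[]//|IT]; split => //.
  exact: subset_trans IT TS.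
rewrite /E; have memIT := fintype.subsetP IT; have memTS := fintype.subsetP TS.
have -> : S :\: I :\: (T :\: I) = S :\: T.
  apply/setP => x; rewrite !inE; have := memIT x.
  by case: (x \in I); case: (x \in T) => // /(_ isT).
rewrite cardsDS // subnKC ?subset_leq_card //.
rewrite -!mulrA [RHS]mulrA -exprD; congr (_ ^+ _ * _).
have -> : S :\: I = (T :\: I) :|: (S :\: T).
  apply/setP => x; rewrite !inE; have := memIT x; have := memTS x.
  case: (x \in I); case: (x \in T); case: (x \in S) => // a b.
  1-2: by first [by move: (a isT) | by move: (b isT)].
have ET : T = I :|: (T :\: I).
  apply/setP => x; rewrite !inE; have := memIT x.
  by case: (x \in I) => //= ->.
have -> : inversions T (S :\: T) =
    (inversions I (S :\: T) + inversions (T :\: I) (S :\: T))%N.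
  rewrite {1}ET inversionsUl // disjoints_subset.
  by apply/fintype.subsetP => x; rewrite !inE => ->.
rewrite inversionsUr; first by rewrite -addnA addnC.
rewrite disjoints_subset; apply/fintype.subsetP => x; rewrite !inE.
by case/andP => _ ->.
Qed.

Lemma gr_1neq0 : gr_one != 0.
Proof. by apply/eqP => /ffunP/(_ set0)/eqP; rewrite !ffunE eqxx oner_eq0. Qed.

HB.instance Definition _ := GRing.Zmodule_isNzRing.Build G
  gr_mulA gr_mul1l gr_mul1r gr_mulDl gr_mulDr gr_1neq0.

Lemma gr_scaleAl (c : F) f g : c *: (f * g) = (c *: f) * g.
Proof.
apply/ffunP => S; rewrite !ffunE scaler_sumr; apply: eq_bigr => I _.
by rewrite !ffunE -scalerAl -!scalerAr.
Qed.

Lemma gr_scaleAr (c : F) f g : c *: (f * g) = f * (c *: g).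
Proof.
apply/ffunP => S; rewrite !ffunE scaler_sumr; apply: eq_bigr => I _.
by rewrite !ffunE linearZ -!scalerAr.
Qed.

HB.instance Definition _ := GRing.Lmodule_isLalgebra.Build F G gr_scaleAl.
HB.instance Definition _ := GRing.Lalgebra_isAlgebra.Build F G gr_scaleAr.
HB.instance Definition _ := Algebra_isFalgebra.Build F G.

End Grassmann.

(* Imported only now: classical_sets shadows the names of finset. *)
From mathcomp Require Import ring_quotient fraction complex.
From mathcomp Require Import boolp classical_sets functions cardinality filter.
From mathcomp Require Import reals topology_structure mpoly.

Local Open Scope classical_set_scope.
Local Open Scope ring_scope.

Section QuotientDomain.
Variables (R : comNzRingType) (I : prime_idealr R).

(* R / I as an integral domain; mathcomp's {ideal_quot I} has no unit ring
   structure, hence no fraction field. *)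
Definition quotient_domain (J : prime_idealr R) : Type := {ideal_quot J}.
HB.instance Definition _ := GRing.ComNzRing.on (quotient_domain I).
Local Notation Q := (quotient_domain I).

Definition qd_unit : {pred Q} := fun x => `[< exists y, y * x = 1 >].
Definition qd_inv (x : Q) : Q :=
  if pselect (exists y, y * x = 1) is left h then projT1 (cid h) else x.

Lemma qd_mulVx : {in qd_unit, left_inverse 1 qd_inv *%R}.
Proof.
move=> x /asboolP xu; rewrite /qd_inv; case: pselect => // h.
by case: (cid h).
Qed.

Lemma qd_unitPl (x y : Q) : y * x = 1 -> x \in qd_unit.
Proof. by move=> h; apply/asboolP; exists y. Qed.

Lemma qd_inv_out : {in [predC qd_unit], qd_inv =1 id}.
Proof.
move=> x /negP xu; rewrite /qd_inv; case: pselect => // h.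
by case: xu; apply/asboolP.
Qed.

HB.instance Definition _ := GRing.ComNzRing_hasMulInverse.Build Q
  qd_mulVx qd_unitPl qd_inv_out.

Lemma qd_integral : GRing.integral_domain_axiom Q.
Proof. exact: Quotient.rquot_IdomainAxiom. Qed.

HB.instance Definition _ := GRing.ComUnitRing_isIntegral.Build Q qd_integral.

Definition qd_pi (x : R) : Q := (\pi_({ideal_quot I}) x)%qT.

Lemma qd_pi_zmod : zmod_morphism qd_pi.
Proof. exact: (rmorphB (\pi_({ideal_quot I}))%qT). Qed.
Lemma qd_pi_monoid : monoid_morphism qd_pi.
Proof. exact: pi_is_monoid_morphism. Qed.

HB.instance Definition _ := GRing.isZmodMorphism.Build R Q qd_pi qd_pi_zmod.
HB.instance Definition _ := GRing.isMonoidMorphism.Build R Q qd_pi qd_pi_monoid.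

Lemma qd_pi_eq0 x : (qd_pi x == 0) = (x \in I).
Proof.
rewrite -[x in RHS]subr0 Quotient.idealrBE.
by rewrite -(rmorph0 qd_pi).
Qed.
End QuotientDomain.

Record subfield (E : fieldType) (S : {pred E}) := Subfield {
  sf_val :> E;
  sf_valP : sf_val \in S
}.

HB.instance Definition _ (E : fieldType) (S : {pred E}) :=
  [isSub for @sf_val E S].
HB.instance Definition _ (E : fieldType) (S : {pred E}) :=
  [Choice of subfield S by <:].

Section Subfield.
Variables (E : fieldType) (S : divringClosed E).

HB.instance Definition _ := [SubChoice_isSubIntegralDomain of subfield S by <:].

Lemma sf_unit : {mono (val : subfield S -> E) : u / u \in GRing.unit}.
Proof.
move=> u; apply/idP/idP => h; last exact: (rmorph_unit (val : subfield S -> E)).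
have hV : (val u)^-1 \in S by rewrite rpredV (valP u).
apply/unitrPr; exists (Subfield hV).
by apply: val_inj; rewrite rmorphM rmorph1 /= mulrV.
Qed.
HB.instance Definition _ :=
  GRing.SubIntegralDomain_isSubField.Build E _ (subfield S) sf_unit.

Lemma sf_val0 : sf_val (0 : subfield S) = 0.
Proof. exact: (rmorph0 (val : subfield S -> E)). Qed.
Lemma sf_val1 : sf_val (1 : subfield S) = 1.
Proof. exact: (rmorph1 (val : subfield S -> E)). Qed.
Lemma sf_valN (x : subfield S) : sf_val (- x) = - sf_val x.
Proof. exact: (rmorphN (val : subfield S -> E)). Qed.
Lemma sf_valD (x y : subfield S) : sf_val (x + y) = sf_val x + sf_val y.
Proof. exact: (rmorphD (val : subfield S -> E)). Qed.
Lemma sf_valM (x y : subfield S) : sf_val (x * y) = sf_val x * sf_val y.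
Proof. exact: (rmorphM (val : subfield S -> E)). Qed.
End Subfield.

Section FunctionField.
Variables (F : fieldType) (n : nat) (I : prime_idealr {mpoly F[n.+1]}).
Local Notation S := (quotient_domain I).

Definition form_class (f : {mpoly F[n.+1]}) : {fraction S} :=
  tofrac (qd_pi I f).
HB.instance Definition _ := GRing.RMorphism.copy form_class
  (@tofrac S \o qd_pi I).

Lemma form_class_eq0 f : (form_class f == 0) = (f \in I).
Proof. by rewrite /form_class tofrac_eq0 qd_pi_eq0. Qed.

(* The classes f / g of forms of the same degree, g not vanishing
   identically on the variety defined by I. *)
Definition degree0 : {pred {fraction S}} := fun x =>
  `[< exists d f g, [/\ f \is d.-homog, g \is d.-homog, g \notin I
      & x = form_class f / form_class g] >].

Lemma degree0_divring_closed : divring_closed degree0.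
Proof.
have neq0 g : g \notin I -> form_class g != 0 by rewrite form_class_eq0.
split.
- apply/asboolP; exists 0%N, 1, 1.
  by rewrite !dhomog1 idealr1 rmorph1 divr1.
- move=> x y /asboolP[d [f [g [hf hg gI ->]]]] /asboolP[e [f' [g' [hf' hg' g'I ->]]]].
  apply/asboolP; exists (d + e)%N, (f * g' - f' * g), (g * g').
  split.
  - by apply: rpredB; [exact: dhomogM | rewrite addnC; exact: dhomogM].
  - exact: dhomogM.
  - by rewrite prime_idealrM negb_or gI g'I.
  - by rewrite -mulNr addf_div ?neq0 // rmorphB !rmorphM /= mulNr.
- move=> x y /asboolP[d [f [g [hf hg gI ->]]]] /asboolP[e [f' [g' [hf' hg' g'I ->]]]].
  apply/asboolP; have [f'I|f'I] := boolP (f' \in I).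
    exists 0%N, 0, 1; rewrite dhomog0 dhomog1 idealr1 rmorph0 mul0r; split=> //.
    by move: f'I; rewrite -form_class_eq0 => /eqP ->; rewrite mul0r invr0 mulr0.
  exists (d + e)%N, (f * g'), (g * f'); split.
  - exact: dhomogM.
  - exact: dhomogM.
  - by rewrite prime_idealrM negb_or gI f'I.
  - by rewrite invf_div mulf_div !rmorphM.
Qed.

HB.instance Definition _ :=
  GRing.isDivringClosed.Build {fraction S} degree0 degree0_divring_closed.

End FunctionField.


Section FunctionField2.
Variables (F : fieldType) (n : nat) (I : prime_idealr {mpoly F[n.+1]}).

Definition function_field : Type := subfield (@degree0 F n I).
HB.instance Definition _ := GRing.Field.on function_field.

Lemma const_degree0 (c : F) : form_class I c%:MP \in @degree0 F n I.
Proof.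
apply/asboolP; exists 0%N, c%:MP, 1; rewrite dhomog1 idealr1 rmorph1 divr1.
split=> //; rewrite (_ : c%:MP = c *: 1) -?mul_mpolyC ?mulr1 //.
by rewrite -[_%:MP]mulr1 mul_mpolyC dhomogZ ?dhomog1.
Qed.

Definition ff_const (c : F) : function_field := Subfield (const_degree0 c).

Lemma ff_const_zmod : zmod_morphism ff_const.
Proof. by move=> a b; apply: val_inj; rewrite /= !rmorphB. Qed.
Lemma ff_const_monoid : monoid_morphism ff_const.
Proof. by split=> [|a b]; apply: val_inj; rewrite /= ?rmorphM ?rmorph1. Qed.
HB.instance Definition _ :=
  GRing.isZmodMorphism.Build F function_field ff_const ff_const_zmod.
HB.instance Definition _ :=
  GRing.isMonoidMorphism.Build F function_field ff_const ff_const_monoid.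
End FunctionField2.

Definition algebraically_independent (F K : fieldType) (iota : {rmorphism F -> K})
    (k : nat) (x : 'I_k -> K) : Prop :=
  forall p : {mpoly F[k]}, mmap iota x p = 0 -> p = 0.

Definition has_transcendence_degree (F K : fieldType)
    (iota : {rmorphism F -> K}) (k : nat) : Prop :=
  (exists x : 'I_k -> K, algebraically_independent iota x) /\
  (forall x : 'I_k.+1 -> K, ~ algebraically_independent iota x).

Section ProjectiveVariety.
Variables (F : fieldType) (n : nat).

(* Points of the n-dimensional projective space are lines of F^(n+1). *)
Definition projective_zeros (I : {pred {mpoly F[n.+1]}}) :
    set {vspace 'rV[F]_n.+1} :=
  [set L | (\dim L = 1)%N /\
    forall (v : 'rV[F]_n.+1) f, v \in L -> f \in I -> f.@[v 0] = 0].

Definition jacobian k (f : 'I_k -> {mpoly F[n.+1]}) (v : 'rV[F]_n.+1) :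
    'M[F]_(k, n.+1) :=
  \matrix_(i, j) ((f i)^`M(j)).@[v 0].

Definition homogeneous_ideal (I : {pred {mpoly F[n.+1]}}) : Prop :=
  forall f d, f \in I -> pihomog mdeg d f \in I.

(* The dimension of the projective variety of I is the transcendence degree of
   its function field. *)
Definition variety_dim (I : prime_idealr {mpoly F[n.+1]}) (k : nat) : Prop :=
  @has_transcendence_degree F (function_field I) (@ff_const F n I) k.

(* Jacobian criterion in P^n for a k-dimensional variety: at every point the
   differentials of the elements of I have rank at least the codimension n - k
   (this rank never exceeds n - k). *)
Definition jacobian_smooth (I : {pred {mpoly F[n.+1]}}) (k : nat) : Prop :=
  forall (L : {vspace 'rV[F]_n.+1}) (v : 'rV[F]_n.+1),
    projective_zeros I L -> v \in L -> v != 0 ->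
  exists2 f : 'I_(n - k) -> {mpoly F[n.+1]},
    (forall i, f i \in I) & \rank (jacobian f v) = (n - k)%N.

End ProjectiveVariety.

(* A smooth projective connected curve is integral, hence is the zero locus of a
   homogeneous prime ideal not containing all the variables. *)
Record smooth_projective_curve (C : closedFieldType) := SmoothProjectiveCurve {
  ambient_dim : nat;
  curve_ideal : prime_idealr {mpoly C[ambient_dim.+1]};
  curve_homogeneous : homogeneous_ideal curve_ideal;
  curve_relevant : exists i : 'I_ambient_dim.+1, 'X_i \notin curve_ideal;
  curve_dim1 : variety_dim curve_ideal 1;
  curve_smooth : jacobian_smooth curve_ideal 1
}.

Section CurvePoints.
Variables (C : closedFieldType) (X : smooth_projective_curve C).

Definition rational_functions : fieldType := function_field (curve_ideal X).

Definition constants : {rmorphism C -> rational_functions} :=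
  @ff_const C (ambient_dim X) (curve_ideal X).

Record curve_point := CurvePoint {
  line_of : {vspace 'rV[C]_(ambient_dim X).+1};
  line_ofP : projective_zeros (curve_ideal X) line_of
}.

(* The local ring at P of the structure sheaf, inside the function field. *)
Definition local_ring (P : curve_point) : set rational_functions :=
  [set x | exists d (f g : {mpoly C[(ambient_dim X).+1]}),
    [/\ f \is d.-homog, g \is d.-homog,
        forall v : 'rV[C]_(ambient_dim X).+1, v \in line_of P -> v != 0 -> g.@[v 0] != 0 &
        sf_val x = form_class (curve_ideal X) f / form_class (curve_ideal X) g]].
End CurvePoints.

Section TensorSpan.
Variables (F K : fieldType) (iota : {rmorphism F -> K}) (A : falgType F).

Definition tens_span (D : set A) (E : set K) : set (base_change iota A) :=
  [set x | exists2 s : seq (A * K), (forall p, p \in s -> D p.1 /\ E p.2)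
    & x = \sum_(p <- s) tens iota p.1 p.2].

Lemma tens_span_tens (D : set A) (E : set K) a k : D a -> E k ->
  tens_span D E (tens iota a k).
Proof.
move=> Da Ek; exists [:: (a, k)]; last by rewrite big_seq1.
by move=> p; rewrite inE => /eqP ->.
Qed.

Lemma tens_spanD (D : set A) (E : set K) x y :
  tens_span D E x -> tens_span D E y -> tens_span D E (x + y).
Proof.
move=> [s sP ->] [t tP ->]; exists (s ++ t); last by rewrite big_cat.
by move=> p; rewrite mem_cat => /orP[/sP|/tP].
Qed.

Lemma tens_span0 (D : set A) (E : set K) : tens_span D E 0.
Proof. by exists [::]; rewrite ?big_nil. Qed.

Lemma tens_spanM (D : set A) (E : set K) x y :
  (forall a b, D a -> D b -> D (a * b)) ->
  (forall a b, E a -> E b -> E (a * b)) ->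
  tens_span D E x -> tens_span D E y -> tens_span D E (x * y).
Proof.
move=> DM EM [s sP ->] [t tP ->]; rewrite mulr_suml.
rewrite big_seq; elim/big_ind: _ => [|u v|p ps]; [exact: tens_span0|exact: tens_spanD|].
rewrite mulr_sumr big_seq; elim/big_ind: _ => [|u v|p' ps']; [exact: tens_span0|exact: tens_spanD|].
rewrite tensM; have [? ?] := sP _ ps; have [? ?] := tP _ ps'.
by apply: tens_span_tens; auto.
Qed.

End TensorSpan.

Section LocalRing.
Variables (C : closedFieldType) (X : smooth_projective_curve C).
Variable P : curve_point X.
Local Notation K := (rational_functions X).
Local Notation cl := (form_class (curve_ideal X)).

Lemma point_basis : exists2 v : 'rV[C]_(ambient_dim X).+1, v != 0 &
  line_of P = <[v]>%VS.
Proof.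
have [d1 _] := line_ofP P.
exists (vpick (line_of P)); first by rewrite vpick0 -dimv_eq0 d1.
apply/eqP; rewrite eq_sym eqEdim -memvE memv_pick d1 dim_vline.
by rewrite vpick0 -dimv_eq0 d1.
Qed.

Lemma local_denom (g : {mpoly C[(ambient_dim X).+1]}) :
  (forall v : 'rV[C]_(ambient_dim X).+1, v \in line_of P -> v != 0 ->
     g.@[v 0] != 0) -> g \notin curve_ideal X.
Proof.
move=> gP; have [v v0 Lv] := point_basis.
have vL : v \in line_of P by rewrite Lv memv_line.
apply/negP => gI; have [_ /(_ v g vL gI)] := line_ofP P.
by apply/eqP/gP.
Qed.

Lemma local_ring0 : local_ring P 0.
Proof.
exists 0%N, 0, 1; split; rewrite ?dhomog0 ?dhomog1 //.
  by move=> v _ _; rewrite rmorph1 oner_neq0.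
by rewrite [form_class _ 0]rmorph0 mul0r sf_val0.
Qed.

Lemma local_ring1 : local_ring P 1.
Proof.
exists 0%N, 1, 1; split; rewrite ?dhomog1 //.
  by move=> v _ _; rewrite rmorph1 oner_neq0.
by rewrite [form_class _ 1]rmorph1 divr1 sf_val1.
Qed.

Lemma local_ringM x y : local_ring P x -> local_ring P y -> local_ring P (x * y).
Proof.
move=> [d [f [g [hf hg gP xE]]]] [e [f' [g' [hf' hg' g'P yE]]]].
exists (d + e)%N, (f * f'), (g * g'); split; try exact: dhomogM.
  by move=> v vP v0; rewrite rmorphM mulf_neq0 ?gP ?g'P.
by rewrite sf_valM xE yE mulf_div; congr (_ / _); rewrite rmorphM.
Qed.

Lemma local_ringN x : local_ring P x -> local_ring P (- x).
Proof.
move=> [d [f [g [hf hg gP xE]]]]; exists d, (- f), g.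
split; rewrite ?rpredN //.
by rewrite sf_valN xE -mulNr; congr (_ / _); rewrite rmorphN.
Qed.

Lemma local_ringD x y : local_ring P x -> local_ring P y -> local_ring P (x + y).
Proof.
move=> [d [f [g [hf hg gP xE]]]] [e [f' [g' [hf' hg' g'P yE]]]].
exists (d + e)%N, (f * g' + f' * g), (g * g'); split.
- by apply: rpredD; [exact: dhomogM | rewrite addnC; exact: dhomogM].
- exact: dhomogM.
- by move=> v vP v0; rewrite rmorphM mulf_neq0 ?gP ?g'P.
- rewrite sf_valD xE yE addf_div ?form_class_eq0; try exact: local_denom.
  by congr (_ / _); rewrite ?rmorphD !rmorphM.
Qed.

Lemma local_ringB x y : local_ring P x -> local_ring P y -> local_ring P (x - y).
Proof. by move=> xP yP; apply: local_ringD => //; exact: local_ringN. Qed.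

Lemma local_fraction x : exists g : K,
  [/\ g != 0, local_ring P g & local_ring P (g * x)].
Proof.
have /asboolP[d [f [h [hf hh hI xE]]]] := sf_valP x.
have [v v0 Lv] := point_basis.
have [i vi] : exists i, v 0 i != 0.
  apply/existsP; apply: contraNT v0 => /existsPn h0.
  apply/eqP/rowP => i; rewrite mxE; apply/eqP; move: (h0 i).
  by rewrite negbK.
pose m : {mpoly C[(ambient_dim X).+1]} := 'X_i ^+ d.
have hm : m \is d.-homog.
  by rewrite -[d]mul1n; apply: dhomogMn; rewrite dhomogX /= mdeg1.
have mP (w : 'rV[C]_(ambient_dim X).+1) :
    w \in line_of P -> w != 0 -> m.@[w 0] != 0.
  rewrite Lv => /vlineP[k ->]; rewrite scaler_eq0 negb_or => /andP[k0 _].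
  by rewrite rmorphXn /= mevalXU mxE expf_neq0 // mulf_neq0.
have mI := local_denom mP.
have gd : cl h / cl m \in @degree0 C _ (curve_ideal X).
  by apply/asboolP; exists d, h, m.
have cl0 z : z \notin curve_ideal X -> cl z != 0 by rewrite form_class_eq0.
exists (Subfield gd); split.
- apply/eqP => /(congr1 (@sf_val _ _)); rewrite sf_val0 /= => /eqP.
  by rewrite mulf_eq0 invr_eq0 !form_class_eq0 (negbTE hI) (negbTE mI).
- by exists d, h, m.
- exists d, f, m; split=> //; rewrite sf_valM /= xE.
  by rewrite mulrC mulrA divfK ?cl0.
Qed.
End LocalRing.

(* A family of subrings of K with fraction field K, e.g. the local rings of a
   curve inside its function field, see [curve_local_rings]. *)
Record local_ring_family (K : fieldType) := LocalRingFamily {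
  points : Type;
  stalk : points -> set K;
  stalk1 : forall P, stalk P 1;
  stalkB : forall P x y, stalk P x -> stalk P y -> stalk P (x - y);
  stalkM : forall P x y, stalk P x -> stalk P y -> stalk P (x * y);
  stalk_fraction : forall P x, exists g,
    [/\ g != 0, stalk P g & stalk P (g * x)]
}.

Definition curve_local_rings (C : closedFieldType)
    (X : smooth_projective_curve C) :
    local_ring_family (rational_functions X) :=
  @LocalRingFamily (rational_functions X) (curve_point X) (@local_ring C X)
    (@local_ring1 C X) (@local_ringB C X) (@local_ringM C X)
    (@local_fraction C X).

Section Repartitions.
Variables (F K : fieldType) (iota : {rmorphism F -> K}).
Variables (X : local_ring_family K) (B : superalgebra F) (q : nat).
Local Notation Bt := (grassmann B q).

(* Lambda[B,q] = B[theta_1, ..., theta_q] (x) K *)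
Definition super_functions : Type := base_change iota Bt.
HB.instance Definition _ := GRing.NzRing.on super_functions.
Local Notation L := super_functions.

(* b theta_I has parity |b| + |I|. *)
Definition grassmann_part (s : bool) : set Bt :=
  [set f | forall I : {set 'I_q}, f I \in part B (s (+) odd #|I|)].

Definition grassmann_const (b : B) : Bt :=
  [ffun I : {set 'I_q} => if I == finset.set0 then b else 0].

Definition super_part (s : bool) : set L :=
  tens_span (grassmann_part s) [set: K].

(* O[B,q]_P: the image in Lambda[B,q] of B[theta_1, ..., theta_q] (x) O_P *)
Definition super_stalk (P : points X) : set L :=
  tens_span [set: Bt] (stalk P).

(* The structure map B -> Lambda[B,q]. *)
Definition scalar (b : B) : L := tens iota (grassmann_const b) 1.

Definition even_units : set L :=
  [set x | super_part false x /\ exists y, x * y = 1 /\ y * x = 1].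

Definition nilpotents : set L := [set x | exists n, x ^+ n = 0].

(* Parity-preserving B-algebra automorphisms of Lambda[B,q]. *)
Definition aut : set (L -> L) := [set alpha |
  [/\ zmod_morphism alpha, monoid_morphism alpha & bijective alpha] /\
  (forall b, alpha (scalar b) = scalar b) /\
  (forall s x, super_part s x -> super_part s (alpha x))].

(* alpha is the identity modulo n(Lambda[B,q]). *)
Definition aut_plus : set (L -> L) := [set alpha |
  aut alpha /\ forall x, nilpotents (alpha x - x)].

(* Maps from the points to G, almost everywhere equal to e. *)
Record Pi0 (T : Type) (G : set T) (e : T) := MkPi0 {
  Pi0_val :> points X -> T;
  Pi0_mem : forall P, G (Pi0_val P);
  Pi0_fin : finite_set [set P | Pi0_val P <> e]
}.

Definition Pi0_aut : Type := Pi0 aut_plus id.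
Definition Pi0_units : Type := Pi0 even_units 1.

Definition is_repartition : {pred points X -> L} :=
  fun r => `[< finite_set [set P | ~ super_stalk P (r P)] >].

Lemma stalkN1 (P : points X) : stalk P (-1).
Proof.
by rewrite -sub0r -[X in X - 1](subrr 1); do 2?apply: stalkB; exact: stalk1.
Qed.

Lemma super_stalk0 P : super_stalk P 0. Proof. exact: tens_span0. Qed.

Lemma super_stalkM P x y :
  super_stalk P x -> super_stalk P y -> super_stalk P (x * y).
Proof. by apply: tens_spanM => // a b; apply: stalkM. Qed.

Lemma super_stalkD P x y :
  super_stalk P x -> super_stalk P y -> super_stalk P (x + y).
Proof. exact: tens_spanD. Qed.

Lemma super_stalk_tens P a k : stalk P k ->
  super_stalk P (tens iota a k).
Proof. by move=> h; apply: tens_span_tens. Qed.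

Lemma super_stalk1 P : super_stalk P 1.
Proof. exact/super_stalk_tens/stalk1. Qed.

Lemma super_stalkN P x : super_stalk P x -> super_stalk P (- x).
Proof.
move=> h; rewrite -mulN1r; apply: super_stalkM => //.
have -> : -1 = tens iota (1 : Bt) (-1) :> L.
  apply/esym/eqP; rewrite -subr_eq0 opprK -[1 in X in _ + X]/(tens _ _ _).
  by rewrite -tensDr addNr; apply/eqP/rowP => i; rewrite !mxE mul0r.
by apply: super_stalk_tens; exact: stalkN1.
Qed.

Lemma super_stalkB P x y :
  super_stalk P x -> super_stalk P y -> super_stalk P (x - y).
Proof. by move=> hx /super_stalkN; apply: super_stalkD. Qed.

Lemma repartition_zmod_closed : zmod_closed is_repartition.
Proof.
split=> [|r s /asboolP rF /asboolP sF].
  apply/asboolP; apply: (@sub_finite_set _ _ set0) => // P /=; apply.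
  exact: super_stalk0.
apply/asboolP.
apply: (@sub_finite_set _ _ ([set P | ~ super_stalk P (r P)] `|`
    [set P | ~ super_stalk P (s P)])); last by rewrite finite_setU.
by move=> P /= h; apply/not_andP => -[hr hs]; apply: h; apply: super_stalkB.
Qed.
HB.instance Definition _ := GRing.isZmodClosed.Build _ is_repartition
  repartition_zmod_closed.

Record repartition := Repartition {
  rep_val :> points X -> L;
  rep_valP : rep_val \in is_repartition
}.
HB.instance Definition _ := [isSub for rep_val].
HB.instance Definition _ := [Choice of repartition by <:].
HB.instance Definition _ := [SubChoice_isSubZmodule of repartition by <:].

(* R(gamma, xi) *)
Definition repartition_nbhd (gamma : Pi0_aut) (xi : Pi0_units) :
    set repartition :=
  [set r | forall P, [set gamma P (xi P * h) | h in super_stalk P] (r P)].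


Lemma grassmann_part1 : grassmann_part false 1.
Proof.
move=> I; rewrite ffunE; case: eqP => [->|_]; last exact: mem0v.
by rewrite cards0 part1.
Qed.

Lemma even_unit_const (g : K) : g != 0 ->
  even_units (tens iota (1 : Bt) g).
Proof.
move=> g0; split; first by apply: tens_span_tens => //; exact: grassmann_part1.
exists (tens iota (1 : Bt) g^-1).
by split; rewrite [LHS]tensM mul1r ?mulfV ?mulVf.
Qed.

Definition ff_scalar (g : K) : L := tens iota (1 : Bt) g.

Lemma ff_scalarM g h : ff_scalar (g * h) = ff_scalar g * ff_scalar h.
Proof. by rewrite [RHS]tensM mulr1. Qed.

Lemma super_stalk_scalar P g : stalk P g -> super_stalk P (ff_scalar g).
Proof. exact: super_stalk_tens. Qed.

Lemma super_ind (Q : L -> Prop) : (forall x y, Q x -> Q y -> Q (x + y)) ->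
  (forall a k, Q (tens iota a k)) -> forall x, Q x.
Proof. exact: tens_ind. Qed.

Lemma super_fraction P (x : L) : exists g : K,
  [/\ g != 0, stalk P g & super_stalk P (x * ff_scalar g)].
Proof.
elim/super_ind: x => [x y [g [g0 gP gx]] [h [h0 hP hy]]|a k].
  exists (g * h); split; [exact: mulf_neq0|exact: stalkM|].
  rewrite mulrDl; apply: super_stalkD.
    rewrite ff_scalarM mulrA.
    exact: super_stalkM gx (super_stalk_scalar hP).
  rewrite (mulrC g) ff_scalarM mulrA.
  exact: super_stalkM hy (super_stalk_scalar gP).
have [g [g0 gP gk]] := stalk_fraction P k; exists g; split => //.
have -> : tens iota a k * ff_scalar g = tens iota a (g * k) :> L.
  by rewrite [LHS]tensM mulr1 mulrC.
exact: super_stalk_tens.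
Qed.

Lemma Pi0_units_meet (xi xi' : Pi0_units) : exists zeta : Pi0_units,
  forall P h, super_stalk P h ->
    [set xi P * k | k in super_stalk P] (zeta P * h) /\
    [set xi' P * k | k in super_stalk P] (zeta P * h).
Proof.
have /choice[zeta zetaP] : forall P, exists z, [/\ even_units z,
    (xi P = 1 -> xi' P = 1 -> z = 1) & forall h, super_stalk P h ->
    [set xi P * k | k in super_stalk P] (z * h) /\
    [set xi' P * k | k in super_stalk P] (z * h)].
  move=> P; have [[x1 x'1]|n1] := pselect (xi P = 1 /\ xi' P = 1).
    exists 1; split=> //; last first.
      by move=> h hP; rewrite x1 x'1; split; exists h.
    by rewrite -x1; exact: Pi0_mem.
  have [_ [y [xy _]]] := Pi0_mem xi P; have [_ [y' [xy' _]]] := Pi0_mem xi' P.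
  have [g [g0 gP gy]] := super_fraction P y.
  have [g' [g'0 g'P gy']] := super_fraction P y'.
  exists (ff_scalar (g * g')); split.
  - exact/even_unit_const/mulf_neq0.
  - by move=> x1 x1'; case: n1.
  - move=> h hP; split.
      exists (y * ff_scalar g * ff_scalar g' * h).
        apply: super_stalkM => //; apply: super_stalkM => //.
        exact: super_stalk_scalar.
      by rewrite ff_scalarM !mulrA xy mul1r.
    exists (y' * ff_scalar g' * ff_scalar g * h).
      apply: super_stalkM => //; apply: super_stalkM => //.
      exact: super_stalk_scalar.
    by rewrite (mulrC g) ff_scalarM !mulrA xy' mul1r.
have zfin : finite_set [set P | zeta P <> 1].
  apply: (@sub_finite_set _ _ ([set P | xi P <> 1] `|` [set P | xi' P <> 1])).
    move=> P /= z1; apply/not_andP => -[x1 x1']; apply: z1.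
    by have [_ -> //] := zetaP P.
  by rewrite finite_setU; split; apply: Pi0_fin.
have zmem P : even_units (zeta P) by have [] := zetaP P.
by exists (MkPi0 zmem zfin) => P h hP; have [_ _ /(_ h hP)] := zetaP P.
Qed.

Lemma repartition_nbhd0 gamma xi : repartition_nbhd gamma xi 0.
Proof.
move=> P; exists 0; first exact: super_stalk0.
have [[[aZ _ _] _] _] := Pi0_mem gamma P.
by rewrite mulr0; have := aZ 0 0; rewrite !subrr.
Qed.

Lemma repartition_nbhdD gamma xi r s : repartition_nbhd gamma xi r ->
  repartition_nbhd gamma xi s -> repartition_nbhd gamma xi (r + s).
Proof.
move=> rP sP P; have [h hO hr] := rP P; have [k kO ks] := sP P.
exists (h + k); first exact: super_stalkD.
have [[[aZ _ _] _] _] := Pi0_mem gamma P.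
have aN x : gamma P (- x) = - gamma P x.
  have a0 : gamma P 0 = 0 by have := aZ 0 0; rewrite !subrr.
  by rewrite -sub0r aZ a0 sub0r.
rewrite mulrDr -[xi P * k]opprK aZ aN opprK.
by rewrite hr ks.
Qed.

(* R[B,q] with the translation-invariant topology in which the sets
   R(gamma, xi) form a base of neighborhoods of 0 *)
Definition repartition_space (gamma : Pi0_aut) : Type := repartition.
HB.instance Definition _ gamma := Choice.on (repartition_space gamma).

Definition repartition_nbhs (gamma : Pi0_aut) (r : repartition) :
    set_system repartition :=
  filter_from [set: Pi0_units]
    (fun xi => [set s | repartition_nbhd gamma xi (s - r)]).

Definition Pi0_unit1 : Pi0_units.
Proof.
apply: (@MkPi0 _ even_units 1 (fun=> 1)).
- move=> P; split; last by exists 1; rewrite mulr1.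
  by apply: tens_span_tens => //; exact: grassmann_part1.
- by apply: (@sub_finite_set _ _ set0) => // P /=; apply.
Defined.

Lemma repartition_nbhs_filter gamma r : ProperFilter (repartition_nbhs gamma r).
Proof.
apply: filter_from_proper; last first.
  by move=> xi _; exists r => /=; rewrite subrr; exact: repartition_nbhd0.
apply: filter_from_filter; first by exists Pi0_unit1.
move=> xi xi' _ _; have [zeta zetaP] := Pi0_units_meet xi xi'.
exists zeta => // s /= sP; split=> P; have [h hO <-] := sP P.
  by have [[k kO <-] _] := zetaP P h hO; exists k.
by have [_ [k kO <-]] := zetaP P h hO; exists k.
Qed.

Lemma repartition_nbhs_singleton gamma r (A : set repartition) :
  repartition_nbhs gamma r A -> A r.
Proof.
by move=> [xi _]; apply; rewrite /= subrr; exact: repartition_nbhd0.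
Qed.

Lemma repartition_nbhs_nbhs gamma r (A : set repartition) :
  repartition_nbhs gamma r A ->
  repartition_nbhs gamma r (fun s => repartition_nbhs gamma s A).
Proof.
move=> [xi _ xiA]; exists xi => // s /= sr; exists xi => // t /= ts.
apply: xiA => /=; rewrite -(subrK s t) -addrA.
exact: repartition_nbhdD.
Qed.

HB.instance Definition _ gamma :=
  hasNbhs.Build (repartition_space gamma) (repartition_nbhs gamma).
HB.instance Definition _ gamma :=
  Nbhs_isNbhsTopological.Build (repartition_space gamma)
    (@repartition_nbhs_filter gamma) (@repartition_nbhs_singleton gamma)
    (@repartition_nbhs_nbhs gamma).

Lemma repartition_nbhs0 (gamma : Pi0_aut) :
  nbhs ((0 : repartition) : repartition_space gamma) =
  filter_from [set: Pi0_units] (repartition_nbhd gamma).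
Proof.
apply/funext => A; apply/propext.
split=> -[xi _ xiA]; exists xi => // r /= rA; apply: xiA => /=.
  by rewrite subr0.
by move: rA; rewrite subr0.
Qed.

Definition repartition_topology (gamma : Pi0_aut) : set (set repartition) :=
  @open (repartition_space gamma).

End Repartitions.

(* Main.v *)
(* Write j for C(X_0) -> Lambda[B,q] and O_P for O[B,q]_P. At the finitely many
   points P where gamma, gamma' or xi is not trivial we need an even unit z with
   gamma'_P (z O_P) contained in gamma_P (xi_P O_P); we take z in C(X_0). Put
   sigma = gamma_P^-1 gamma'_P. Each nu_f = sigma (j f) - j f is central and
   nilpotent, because j f is central. The local ring at P is a localization of
   a finitely generated algebra, say with generators x_1, ..., x_n, so sigma
   maps it into M = O_P[nu_(x_1), ..., nu_(x_n)]: inverses are recovered by the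
   geometric series. The nu's being nilpotent, M is a finite O_P-module, hence
   M g is contained in O_P for some g <> 0 in the local ring. Finally, if
   nu_u^N = 0, then sigma (j u)^N = sigma (j u)^N - nu_u^N is a multiple of j u
   in M; for u divisible by g and by the denominators of xi_P^-1 and of the
   images of a basis of B[theta], z = j u^N works. *)
From HB Require Import structures.
Require Import Defs.
From mathcomp Require Import all_boot all_order all_algebra all_field.
From mathcomp Require Import complex reals.
From mathcomp Require Import mpoly boolp classical_sets cardinality topology.

Set Implicit Arguments.
Unset Strict Implicit.
Unset Printing Implicit Defensive.

Import GRing.Theory.

Local Open Scope classical_set_scope.
Local Open Scope ring_scope.

(** * Central and nilpotent elements, and subrings with bounded denominators *)

Definition central (L : nzRingType) (z : L) : Prop := forall x, GRing.comm z x.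

Lemma centralB (L : nzRingType) (x y : L) :
  central x -> central y -> central (x - y).
Proof. by move=> xC yC z; rewrite /GRing.comm mulrBl mulrBr xC yC. Qed.

Lemma mulr_central (L : nzRingType) (y d c g m a b : L) :
  central c -> central g -> central m ->
  y * (d * c * g * m * (a * b)) = y * d * (a * c) * (m * b * g).
Proof.
move=> cC gC mC; rewrite -!mulrA; congr (y * (d * _)).
by rewrite (mulrA m) mC -!mulrA gC -!mulrA mulrA cC -!mulrA.
Qed.

Section NilpotentAdjunction.
Variables (L : nzRingType) (O : subringClosed L) (D : {pred L}).
Hypotheses (D1 : 1 \in D) (DM : {in D &, forall c d, c * d \in D}).
Hypotheses (DO : {subset D <= O}) (Dcentral : {in D, forall d, central d}).
Hypothesis Dfrac : forall x, exists2 d, d \in D & x * d \in O.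

Lemma common_denominator (s : seq L) :
  exists2 d, d \in D & {in s, forall x, x * d \in O}.
Proof.
elim: s => [|x s [d dD ds]]; first by exists 1.
have [c cD xc] := Dfrac x; exists (c * d); first exact: DM.
move=> y; rewrite inE => /orP[/eqP->|ys].
  by rewrite mulrA rpredM // DO.
by rewrite (Dcentral cD d) mulrA rpredM ?ds // DO.
Qed.

(** As [n ^+ k = 0], the ring [M[n]] is spanned over [M] by finitely many powers of [n], so one
    denominator for these powers, times the one for [M], is enough. *)
Lemma adjoin_nilpotent (M : subringClosed L) (d n : L) (k : nat) :
    d \in D -> {subset O <= M} -> {in M, forall x, x * d \in O} ->
    central n -> n ^+ k = 0 ->
  exists (M' : subringClosed L) (d' : L),
    [/\ d' \in D, {subset M <= M'}, n \in M' & {in M', forall x, x * d' \in O}].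
Proof.
move=> dD OM Md nC nk.
(* Evaluation at [n] is multiplicative because [n] is central, although [L] need not be
   commutative. *)
pose S : {pred L} := fun x => `[< exists2 p, p \is a polyOver M & x = p.[n] >].
have Scl : subring_closed S.
  split=> [|x y /asboolP[p pM ->] /asboolP[p' pM' ->]
           |x y /asboolP[p pM ->] /asboolP[p' pM' ->]]; apply/asboolP.
  - by exists 1; rewrite ?rpred1 // hornerC.
  - by exists (p - p'); rewrite ?rpredB // hornerD hornerN.
  - by exists (p * p'); rewrite ?rpredM // hornerM_comm //; exact: nC.
pose M' : subringClosed L := HB.pack S (GRing.isSubringClosed.Build L S Scl).
have [c cD cn] := common_denominator [seq n ^+ i | i <- iota 0 k].
exists M', (d * c); split; first exact: DM.
- by move=> x xM; apply/asboolP; exists x%:P; rewrite ?polyOverC ?hornerC.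
- by apply/asboolP; exists 'X; rewrite ?polyOverX ?hornerX.
- move=> x /asboolP[p /polyOverP pM ->].
  rewrite horner_coef mulr_suml rpred_sum // => i _.
  have [ik|ki] := ltnP i k; last first.
    by rewrite -(subnK ki) exprD nk !mulr0 mul0r rpred0.
  have -> : p`_i * n ^+ i * (d * c) = (p`_i * d) * (n ^+ i * c).
    by rewrite mulrA -(mulrA p`_i) -(Dcentral dD) !mulrA.
  rewrite rpredM ?Md // cn //; apply: map_f.
  by rewrite mem_iota.
Qed.

Lemma adjoin_nilpotents (s : seq L) :
    {in s, forall n, central n /\ exists k, n ^+ k = 0} ->
  exists (M : subringClosed L) (d : L),
    [/\ d \in D, {subset O <= M}, {subset s <= M}
      & {in M, forall x, x * d \in O}].
Proof.
elim: s => [_|n s IH sN].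
  by exists O, 1; split=> // x xO; rewrite mulr1.
have [|M [d [dD OM sM Md]]] := IH.
  by move=> m ms; apply: sN; rewrite inE ms orbT.
have [nC [k nk]] : central n /\ exists k, n ^+ k = 0.
  by apply: sN; rewrite mem_head.
have [M' [d' [d'D MM' nM' Md']]] := adjoin_nilpotent dD OM Md nC nk.
exists M', d'; split=> // x; first by move=> /OM /MM'.
by rewrite inE => /orP[/eqP->//|/sM /MM'].
Qed.

End NilpotentAdjunction.

(** Each term of the binomial expansion contains [x] at least [m] times or [y] at least [n]
    times. *)
Lemma nilpotentB_comm (L : nzRingType) (x y : L) (m n : nat) :
  GRing.comm x y -> x ^+ m = 0 -> y ^+ n = 0 -> (x - y) ^+ (m + n) = 0.
Proof.
move=> xy xm yn; rewrite exprBn_comm // big1 // => i _.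
have [ni|/ltnW in_] := leqP n i.
  have -> : y ^+ i = 0 by rewrite -(subnK ni) exprD yn mulr0.
  by rewrite mulr0 mul0rn.
have -> : x ^+ (m + n - i) = 0 by rewrite -addnBA // exprD xm mul0r.
by rewrite mulr0 mul0r mul0rn.
Qed.

(** The geometric series of [- x] stops after [k] terms and is an inverse of [1 + x] lying in [M];
    the left inverse [y] must equal it. *)
Lemma inv_nilpotent_mem (L : nzRingType) (M : subringClosed L) (x y : L) k :
  x \in M -> x ^+ k = 0 -> y * (1 + x) = 1 -> y \in M.
Proof.
move=> xM xk yx; have e : (1 + x) * (\sum_(i < k) (- x) ^+ i) = 1.
  have := subrX1 (- x) k; rewrite exprNn xk mulr0 sub0r => /eqP.
  by rewrite -opprD (addrC x) mulNr eqr_opp => /eqP <-.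
rewrite -[y]mulr1 -e mulrA yx mul1r rpred_sum // => i _.
by rewrite rpredX ?rpredN.
Qed.

(** * The conductor of a unipotent endomorphism at one point *)

Section Conductor.
Variables (F K : fieldType) (iota : {rmorphism F -> K}).
Variables (X : local_ring_family K) (B : superalgebra F) (q : nat).
Variable P : points X.
Local Notation L := (super_functions iota B q).
Local Notation j := (ff_scalar iota B q).

Lemma ff_scalar_zmod : zmod_morphism j.
Proof. by move=> x y; apply/rowP => i; rewrite !mxE mulrBl. Qed.

Lemma ff_scalar_monoid : monoid_morphism j.
Proof. by split=> // x y; exact: ff_scalarM. Qed.

HB.instance Definition _ := GRing.isZmodMorphism.Build K L j ff_scalar_zmod.
HB.instance Definition _ := GRing.isMonoidMorphism.Build K L j ff_scalar_monoid.

Lemma ff_scalar_central g : central (j g).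
Proof.
move=> x; rewrite /GRing.comm; elim/super_ind: x => [x y xg yg|a k].
  by rewrite mulrDl mulrDr xg yg.
by rewrite [LHS]tensM [RHS]tensM mul1r mulr1 mulrC.
Qed.

(** Places the constants of [F] inside the image of [B], so that every automorphism over [B] fixes
    them. *)
Lemma ff_scalar_iota c : j (iota c) = Defs.scalar iota q (c *: (1 : B)).
Proof.
rewrite /Defs.scalar -[iota c]mulr1 /ff_scalar -tensZl; congr tens.
by apply/ffunP => I; rewrite !ffunE; case: ifP; rewrite ?scaler0.
Qed.

Definition super_stalk_pred : {pred L} := fun x => `[< super_stalk P x >].

Lemma super_stalk_pred_subring : subring_closed super_stalk_pred.
Proof.
split=> [|x y /asboolP xP /asboolP yP|x y /asboolP xP /asboolP yP]; apply/asboolP.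
- exact: super_stalk1.
- exact: super_stalkB.
- exact: super_stalkM.
Qed.
HB.instance Definition _ :=
  GRing.isSubringClosed.Build L super_stalk_pred super_stalk_pred_subring.

Lemma tens_ff_scalar (a : grassmann B q) k :
  tens iota a k = tens iota a 1 * j k :> L.
Proof. by rewrite [RHS]tensM mulr1 mul1r. Qed.

(* [S] is a localization of the F-algebra generated by [s]. *)
Definition essentially_generated (S : set K) (s : seq K) : Prop :=
  [/\ {in s, forall x, S x}, forall c, S (iota c) &
    forall T : set K, (forall c, T (iota c)) -> {in s, forall x, T x} ->
      (forall x y, T x -> T y -> T (x + y)) ->
      (forall x y, T x -> T y -> T (x * y)) ->
      (forall x, T x -> x != 0 -> S x^-1 -> T x^-1) -> S `<=` T].

Definition denominators : {pred L} :=
  fun x => `[< exists g, [/\ g != 0, stalk P g & x = j g] >].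

Lemma denominators1 : 1 \in denominators.
Proof.
by apply/asboolP; exists 1; rewrite oner_neq0; split=> //; exact: stalk1.
Qed.

Lemma denominatorsM : {in denominators &, forall c d, c * d \in denominators}.
Proof.
move=> _ _ /asboolP[g [g0 gP ->]] /asboolP[h [h0 hP ->]]; apply/asboolP.
by exists (g * h); rewrite mulf_neq0 // rmorphM; split=> //; exact: stalkM.
Qed.

Lemma denominators_stalk : {subset denominators <= super_stalk_pred}.
Proof.
by move=> _ /asboolP[g [_ gP ->]]; apply/asboolP; exact: super_stalk_scalar.
Qed.

Lemma denominators_central : {in denominators, forall d, central d}.
Proof. by move=> _ /asboolP[g [_ _ ->]]; exact: ff_scalar_central. Qed.

Lemma denominators_fraction (x : L) :
  exists2 d, d \in denominators & x * d \in super_stalk_pred.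
Proof.
have [g [g0 gP xg]] := super_fraction P x.
by exists (j g); apply/asboolP => //; exists g.
Qed.

Variables (s : seq K) (sigma : {rmorphism L -> L}).
Hypothesis sP : essentially_generated (stalk P) s.
Hypothesis sigma_iota : forall c, sigma (j (iota c)) = j (iota c).
Hypothesis sigma_central : forall k, central (sigma (j k)).
Hypothesis sigma_nilpotent : forall k, nilpotents (sigma (j k) - j k).

Lemma central_sigmaB k : central (sigma (j k) - j k).
Proof. exact: centralB (sigma_central k) (ff_scalar_central k). Qed.

Lemma sigma_stalk_enclosed : exists (M : subringClosed L) (g : K),
  [/\ g != 0, stalk P g, {subset super_stalk_pred <= M},
      forall k, stalk P k -> sigma (j k) \in M
    & {in M, forall x, super_stalk P (x * j g)}].
Proof.
have [sS iS sgen] := sP.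
have nil : {in [seq sigma (j k) - j k | k <- s],
    forall n, central n /\ exists k, n ^+ k = 0}.
  move=> _ /mapP[k ks ->]; split; first exact: central_sigmaB.
  exact: sigma_nilpotent.
have [M [_ [/asboolP[g [g0 gP ->]] OM sM Mg]]] := adjoin_nilpotents
  denominators1 denominatorsM denominators_stalk denominators_central
  denominators_fraction nil.
have jM k : stalk P k -> j k \in M.
  by move=> kP; apply: OM; apply/asboolP; exact: super_stalk_scalar.
exists M, g; split=> // [k kP|x /Mg /asboolP//].
(* The elements that [sigma] sends into [M] satisfy all the closure conditions of a localization
   containing the generators. *)
apply: (sgen [set k | sigma (j k) \in M]) kP => /=.
- by move=> c; rewrite sigma_iota jM.
- move=> x xs /=; have -> : sigma (j x) = (sigma (j x) - j x) + j x by rewrite subrK.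
  rewrite rpredD ?jM //; last exact: sS.
  by apply: sM; apply/mapP; exists x.
- by move=> x y xM yM; rewrite !rmorphD rpredD.
- by move=> x y xM yM; rewrite !rmorphM rpredM.
(* Inverses: [sigma (j x) * j x^-1] is 1 plus a nilpotent element of [M], so its inverse
   [sigma (j x^-1) * j x] lies in [M] as well. *)
move=> x xM x0 xP; have [l nk] := sigma_nilpotent x.
set nu := sigma (j x) - j x in nk.
have e : 1 + nu * j x^-1 = sigma (j x) * j x^-1.
  by rewrite /nu mulrBl -[j x * _]rmorphM divff // rmorph1 addrC subrK.
have nuM : nu * j x^-1 \in M.
  rewrite /nu mulrBl; apply: rpredB; first by rewrite rpredM ?jM.
  by rewrite -ff_scalarM divff ?rpred1.
have yM : sigma (j x^-1) * j x \in M.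
  apply: (inv_nilpotent_mem (k := l) nuM).
    by rewrite exprMn_comm ?nk ?mul0r //; exact: central_sigmaB.
  rewrite e mulrA -(mulrA _ (j x)) (ff_scalar_central x) mulrA.
  rewrite -rmorphM -rmorphM mulVf // !rmorph1 mul1r.
  by rewrite -rmorphM divff // rmorph1.
have -> : sigma (j x^-1) = sigma (j x^-1) * j x * j x^-1.
  by rewrite -mulrA -rmorphM divff // rmorph1 mulr1.
by rewrite rpredM // jM.
Qed.

Lemma sigma_conductor (xi : L) : even_units xi -> exists2 t, t != 0 &
  forall h, super_stalk P h ->
    exists2 k, super_stalk P k & sigma (j t * h) = xi * k.
Proof.
move=> [_ [y [xiy _]]].
have [M [g [g0 gP OM sM Mg]]] := sigma_stalk_enclosed.
have [_ /asboolP[d [d0 dP ->]] yd] := denominators_fraction y.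
pose e := vbasis {:grassmann B q}.
have [_ /asboolP[c [c0 cP ->]] ec] := common_denominator
  denominators1 denominatorsM denominators_stalk denominators_central
  denominators_fraction [seq sigma (tens iota a 1) | a <- e].
(* From the basis to every [a]: the coordinates over [F] are fixed by [sigma] and lie in the local
   ring. *)
have ac a : super_stalk P (sigma (tens iota a 1) * j c).
  rewrite (coordE a) tens_suml rmorph_sum mulr_suml.
  elim/big_ind: _ => [|x z|i _]; [exact: super_stalk0|exact: super_stalkD|].
  rewrite tensZl tens_ff_scalar rmorphM mulr1 sigma_iota -mulrA.
  rewrite [j (iota _) * _]ff_scalar_central mulrA; apply: super_stalkM.
    by apply/asboolP/ec/map_f/mem_nth; rewrite size_tuple.
  by apply: super_stalk_scalar; have [] := sP.
(* [d] clears the denominator of [y], the inverse of [xi]; [c] those of the images of the basis; [g]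
   those of [M]. *)
pose u := d * c * g; have u0 : u != 0 by rewrite !mulf_neq0.
have uP : stalk P u by do 2?apply: stalkM.
have [N nN] := sigma_nilpotent u.
(* Factor the difference of the [N]-th powers of [sigma (j u)] and of the nilpotent
   [sigma (j u) - j u]: the second power vanishes, and the bases differ by [j u]. *)
have [m mM mE] : exists2 m, m \in M & sigma (j (u ^+ N)) = j u * m.
  have := subrXX_comm N (sigma_central u (sigma (j u) - j u)).
  rewrite nN subr0 opprB addrC subrK => uN; rewrite !rmorphXn uN; eexists=> //.
  rewrite rpred_sum // => i _; have ujM : j u \in M.
    by apply: OM; apply/asboolP; exact: super_stalk_scalar.
  by rewrite rpredM ?rpredX ?rpredB ?sM.
have mC : central m.
  have -> : m = j u^-1 * sigma (j (u ^+ N)).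
    by rewrite mE mulrA -rmorphM mulVf // rmorph1 mul1r.
  move=> x; rewrite /GRing.comm -mulrA sigma_central mulrA ff_scalar_central.
  by rewrite mulrA.
exists (u ^+ N); first exact: expf_neq0.
move=> h hP; exists (y * sigma (j (u ^+ N) * h)); last by rewrite mulrA xiy mul1r.
have [r rP ->] := hP.
rewrite mulr_sumr rmorph_sum mulr_sumr big_seq.
elim/big_ind: _ => [|x z|p /rP[_ pP]]; [exact: super_stalk0|exact: super_stalkD|].
rewrite tens_ff_scalar !rmorphM mE.
rewrite /u !ff_scalarM.
(* Each factor of [u] moves next to what it clears: [d] to [y], [c] to the image of the Grassmann
   coefficient, [g] to the element of [M]. *)
rewrite (mulr_central _ _ _ _ (ff_scalar_central c) (ff_scalar_central g) mC).
apply: super_stalkM; first by apply: super_stalkM; [exact/asboolP|exact: ac].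
by apply: Mg; rewrite rpredM ?sM.
Qed.
End Conductor.

(** * Comparison of the neighborhoods for two families of automorphisms *)

Section Comparison.
Variables (F K : fieldType) (iota : {rmorphism F -> K}).
Variables (X : local_ring_family K) (B : superalgebra F) (q : nat).
Local Notation L := (super_functions iota B q).
Local Notation j := (ff_scalar iota B q).
Hypothesis stalk_gen : forall P : points X,
  exists s, essentially_generated iota (stalk P) s.

Lemma aut_plus_conductor (P : points X) (alpha beta : L -> L) (xi : L) :
    aut_plus alpha -> aut_plus beta -> even_units xi ->
  exists2 t, t != 0 & forall h, super_stalk P h ->
    exists2 k, super_stalk P k & beta (j t * h) = alpha (xi * k).
Proof.
move=> [[[aZ aM [a' aK a'K]] [aB _]] aN] [[[bZ bM [b' bK b'K]] [bB _]] bN] xiU.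
pose a : {rmorphism L -> L} := HB.pack alpha
  (GRing.isZmodMorphism.Build L L alpha aZ)
  (GRing.isMonoidMorphism.Build L L alpha aM).
pose b : {rmorphism L -> L} := HB.pack beta
  (GRing.isZmodMorphism.Build L L beta bZ)
  (GRing.isMonoidMorphism.Build L L beta bM).
have a'Z : zmod_morphism a'.
  by move=> x y; rewrite -[in LHS](a'K x) -[in LHS](a'K y) -(rmorphB a) aK.
have a'M : monoid_morphism a'.
  split; first by rewrite -[in LHS](rmorph1 a) aK.
  by move=> x y; rewrite -[in LHS](a'K x) -[in LHS](a'K y) -(rmorphM a) aK.
pose i : {rmorphism L -> L} := HB.pack a'
  (GRing.isZmodMorphism.Build L L a' a'Z)
  (GRing.isMonoidMorphism.Build L L a' a'M).
pose sigma : {rmorphism L -> L} := i \o b.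
(* A surjective ring morphism maps central elements to central elements. *)
have central_img (f : {rmorphism L -> L}) f' k : cancel f' f -> central (f (j k)).
  move=> f'K x; rewrite /GRing.comm -(f'K x) -!rmorphM.
  by rewrite (ff_scalar_central k).
have [s sP] := stalk_gen P.
have sigma_iota c : sigma (j (iota c)) = j (iota c).
  by rewrite /= ff_scalar_iota bB -[in LHS]aB aK.
have sigma_central k : central (sigma (j k)).
  by apply: (central_img sigma (b' \o a)) => x /=; rewrite b'K aK.
have sigma_nilpotent k : nilpotents (sigma (j k) - j k).
  (* Apply [alpha]: the image of [sigma (j k) - j k] is the difference of the nilpotents
     [beta (j k) - j k] and [alpha (j k) - j k], which commute since the first is central. *)
  have [m am] := aN (j k); have [n bn] := bN (j k).
  exists (n + m)%N; apply: (can_inj aK).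
  have -> : alpha ((sigma (j k) - j k) ^+ (n + m)) =
      ((beta (j k) - j k) - (alpha (j k) - j k)) ^+ (n + m).
    rewrite -[alpha]/(a : L -> L) rmorphXn rmorphB /= a'K.
    by rewrite opprB addrA subrK.
  rewrite -[alpha]/(a : L -> L) rmorph0 nilpotentB_comm //.
  exact/centralB/ff_scalar_central/(central_img b b' k b'K).
have [t t0 tP] := sigma_conductor sP sigma_iota sigma_central sigma_nilpotent xiU.
by exists t => // h /tP[k kP e]; exists k => //; rewrite -e /= a'K.
Qed.

Lemma repartition_nbhd_refine (gamma gamma' : Pi0_aut iota X B q)
    (xi : Pi0_units iota X B q) : exists zeta : Pi0_units iota X B q,
  repartition_nbhd gamma' zeta `<=` repartition_nbhd gamma xi.
Proof.
(* The second clause makes the chosen [zeta] equal to 1 at all but finitely many points. *)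
have /choice[zeta zetaP] : forall P, exists z, [/\ even_units z,
    (gamma P = id -> gamma' P = id -> xi P = 1 -> z = 1) &
    forall h, super_stalk P h ->
      exists2 k, super_stalk P k & gamma' P (z * h) = gamma P (xi P * k)].
  move=> P; have [[g1 [g'1 x1]]|n1] :=
      pselect (gamma P = id /\ gamma' P = id /\ xi P = 1).
    exists 1; split=> //; first by rewrite -x1; exact: Pi0_mem.
    by move=> h hP; exists h; rewrite // g1 g'1 x1.
  have [t t0 tP] := aut_plus_conductor P (Pi0_mem gamma P) (Pi0_mem gamma' P)
    (Pi0_mem xi P).
  exists (j t); split=> //; first exact: even_unit_const.
  by move=> *; case: n1.
have zmem P : even_units (zeta P) by have [] := zetaP P.
have zfin : finite_set [set P | zeta P <> 1].
  apply: (@sub_finite_set _ _ ([set P | gamma P <> id] `|`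
    [set P | gamma' P <> id] `|` [set P | xi P <> 1])).
    move=> P /= z1; apply: contrapT.
    move=> /not_orP[/not_orP[/contrapT g1 /contrapT g'1] /contrapT x1]; apply: z1.
    by have [_ -> //] := zetaP P.
  by rewrite !finite_setU; do 2?split; apply: Pi0_fin.
exists (MkPi0 zmem zfin) => r rz P; have [h hP <-] := rz P.
by have [_ _ /(_ h hP)[k kP ->]] := zetaP P; exists k.
Qed.

Lemma repartition_nbhs_sub (gamma gamma' : Pi0_aut iota X B q)
    (r : repartition iota X B q) :
  repartition_nbhs gamma r `<=` repartition_nbhs gamma' r.
Proof.
move=> A [xi _ xiA]; have [zeta zx] := repartition_nbhd_refine gamma gamma' xi.
by exists zeta => // s /= /zx; exact: xiA.
Qed.

Lemma repartition_topology_indep (gamma gamma' : Pi0_aut iota X B q) :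
  repartition_topology gamma = repartition_topology gamma'.
Proof.
have e (r : repartition iota X B q) :
    repartition_nbhs gamma r = repartition_nbhs gamma' r.
  by apply/seteqP; split; exact: repartition_nbhs_sub.
rewrite /repartition_topology; apply/funext => A.
rewrite !openE; apply/propext.
by split=> h r /h; rewrite /interior /nbhs /= e.
Qed.
End Comparison.

(** * Local rings of a curve as localizations of finitely generated algebras *)

Lemma local_ring_essentially_generated (C : closedFieldType)
    (X : smooth_projective_curve C) (P : curve_point X) :
  exists s, essentially_generated (constants X) (local_ring P) s.
Proof.
have [v v0 Lv] := point_basis P.
(* The affine chart where ['X_i] does not vanish contains [P]; its coordinates ['X_k / 'X_i] will be
   the generators. *)
have [i vi] : exists i, v 0 i != 0.
  apply/existsP; apply: contraNT v0 => /existsPn h0.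
  by apply/eqP/rowP => i; rewrite mxE; apply/eqP; move: (h0 i); rewrite negbK.
have xiP (w : 'rV[C]_(ambient_dim X).+1) d :
    w \in line_of P -> w != 0 -> ('X_i ^+ d).@[w 0] != 0.
  rewrite Lv => /vlineP[k ->]; rewrite scaler_eq0 negb_or => /andP[k0 _].
  by rewrite rmorphXn /= mevalXU mxE expf_neq0 // mulf_neq0.
have hX k d : ('X_k : {mpoly C[(ambient_dim X).+1]}) ^+ d \is d.-homog for mdeg.
  rewrite -[X in X.-homog]mul1n; apply: dhomogMn.
  by rewrite dhomogX /= mdeg1.
pose cl := form_class (curve_ideal X).
have clX0 : cl 'X_i != 0.
  rewrite form_class_eq0; apply: (local_denom (P := P)) => w wP w0.
  by have := xiP w 1 wP w0.
have /choice[x xE] k : exists x : rational_functions X, sf_val x = cl 'X_k / cl 'X_i.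
  have h : cl 'X_k / cl 'X_i \in @degree0 C _ (curve_ideal X).
    apply/asboolP; exists 1%N, 'X_k, 'X_i.
    by rewrite (hX _ 1%N) (hX _ 1%N) -form_class_eq0.
  by exists (Subfield h).
exists (codom x); split=> [_ /codomP[k ->]|c|T Tc Tx TD TM TV].
- exists 1%N, 'X_k, 'X_i; rewrite !(hX _ 1%N); split=> // w wP w0.
  by have := xiP w 1%N wP w0.
- exists 0%N, c%:MP, 1; rewrite dhomog1 rmorph1 divr1; split=> //.
    by rewrite -[c%:MP]mulr1 mul_mpolyC dhomogZ ?dhomog1.
  by move=> w _ _; rewrite rmorph1 oner_neq0.
(* Dehomogenization: on a form of degree [d], [ev] is division by ['X_i ^+ d]. *)
pose ev p := mmap (constants X) x p.
have T1 : T 1 by rewrite -(rmorph1 (constants X)).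
have Tev p : T (ev p).
  rewrite /ev /mmap; elim/big_ind: _ => [||m _]; [|exact: TD|].
    by rewrite -(rmorph0 (constants X)).
  apply/TM => //; rewrite /mmap1; elim/big_ind: _ => [||k _].
  - exact: T1.
  - exact: TM.
  elim: (m k) => [|e IH]; first by rewrite expr0.
  by rewrite exprS; apply: (TM) => //; apply: Tx; exact: codom_f.
have evE d p : p \is d.-homog for mdeg -> sf_val (ev p) = cl p / cl 'X_i ^+ d.
  move=> /dhomogP hp; rewrite -[sf_val _]/(val (ev p)) rmorph_sum.
  rewrite [in RHS](mpolyE p) /cl rmorph_sum mulr_suml; apply: eq_big_seq => m mp.
  rewrite rmorphM -mul_mpolyC rmorphM -mulrA; congr (_ * _).
  have -> : d = (\sum_k m k)%N by rewrite -(hp m mp) /= mdegE.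
  rewrite /mmap1 rmorph_prod mpolyXE_id rmorph_prod -prodrXr.
  rewrite -prodf_div; apply: eq_bigr => k _.
  by rewrite !rmorphXn /= xE expr_div_n.
move=> f [d [g [h [hg hh hP fE]]]].
have clh0 : cl h != 0 by rewrite form_class_eq0 (local_denom hP).
have clXd0 : cl 'X_i ^+ d != 0 := expf_neq0 d clX0.
have qh0 : cl h / cl 'X_i ^+ d != 0 := mulf_neq0 clh0 (invr_neq0 clXd0).
have evh0 : ev h != 0.
  by apply/eqP => e; move: qh0; rewrite -(evE d h hh) e sf_val0 eqxx.
(* The numerator and denominator have the same degree, so the powers of ['X_i] cancel. *)
have -> : f = ev g * (ev h)^-1.
  apply: (canRL (mulfK evh0)); apply: val_inj.
  rewrite [LHS]sf_valM [RHS](evE d g hg) (evE d h hh) fE mulrA.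
  by rewrite (divfK clh0).
apply: TM; first exact: Tev.
apply: TV; [exact: Tev|exact: evh0|].
(* The inverse of [ev h] is the class of ['X_i ^+ d / h], which is regular at [P]. *)
exists d, ('X_i ^+ d), h; split; [exact: hX|exact: hh|exact: hP|].
have e : sf_val (ev h) * sf_val (ev h)^-1 = 1.
  by rewrite -sf_valM (divff evh0) sf_val1.
rewrite (evE d h hh) in e; apply: (mulfI qh0).
have clXn : cl ('X_i ^+ d) = cl 'X_i ^+ d by rewrite /cl rmorphXn.
by rewrite e -/cl clXn mulrA (divfK clXd0) (divff clh0).
Qed.

Theorem proposition3 (R : realType) (B : superalgebra R[i]) (q : nat)
    (X0 : smooth_projective_curve R[i])
    (hBcomm : supercommutative B) (hBlocal : local_algebra B)
    (hq : (0 < q)%N)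
    (gamma gamma' : Pi0_aut (constants X0) (curve_local_rings X0) B q) :
  repartition_topology gamma = repartition_topology gamma'.
Proof.
apply: repartition_topology_indep; exact: local_ring_essentially_generated.
Qed.
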